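(* Assume $\beta\ge 0$ and $\zeta_l+\zeta_r>0$. Then $$\mathcal{J}_\beta(N)=4(\alpha_{in}^l\alpha_{out}^r-\alpha_{out}^l\alpha_{in}^r)\int_0^\infty\langle e_1,T_t(p_N)e_1\rangle\,dt=-4(\alpha_{in}^l\alpha_{out}^r-\alpha_{out}^l\alpha_{in}^r)\langle e_1,l^{-1}(p_N)e_1\rangle .$$
   Context: Fix an integer $N\ge 2$ and a bounded function $v:\mathbb{N}=\{1,2,\dots\}\to\mathbb{R}$. Let $e_1,\dots,e_N$ be the standard basis of $\mathbb{C}^N$, with inner product $\langle x,y\rangle=\sum_i\overline{x_i}y_i$, and $p_n=|e_n\rangle\langle e_n|$. Let $h$ be the Hermitian $N\times N$ matrix $(h\psi)(n)=-\psi(n+1)-\psi(n-1)+v(n)\psi(n)$, $n=1,\dots,N$, with $\psi(0)=\psi(N+1)=0$. Let $\alpha_{in}^l,\alpha_{out}^l,\alpha_{in}^r,\alpha_{out}^r,\beta\ge 0$ and $\zeta_l=\alpha_{in}^l+\alpha_{out}^l$, $\zeta_r=\alpha_{in}^r+\alpha_{out}^r$. Define $l:M_N(\mathbb{C})\to M_N(\mathbb{C})$ by $l(a)=-i[h,a]-\{\zeta_l p_1+\zeta_r p_N,a\}+\beta\left(\sum_{n=1}^N p_nap_n-a\right)$ ($[x,y]=xy-yx$, $\{x,y\}=xy+yx$), and $T_t=e^{tl}$, $t\ge0$. Under the hypotheses, all eigenvalues of $l$ have negative real part, so $l$ is invertible and $R_\infty=\int_0^\infty T_s(2\alpha_{in}^l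 p_1+2\alpha_{in}^r p_N)\,ds$ converges. The stationary current is defined as $\mathcal{J}_\beta(N)=2\,\mathrm{Im}\langle e_2,R_\infty e_1\rangle$. *)

(* Defs.v *)
From HB Require Import structures.
From mathcomp Require Import all_boot all_order all_algebra.
From mathcomp Require Import all_classical all_reals all_analysis.
From mathcomp Require Import complex.
Set Implicit Arguments. Unset Strict Implicit. Unset Printing Implicit Defensive.
Import Order.TTheory GRing.Theory Num.Theory.
Import numFieldNormedType.Exports.
Local Open Scope classical_set_scope.
Local Open Scope ring_scope.
Local Open Scope complex_scope.

Section Model.
Variable R : realType.
Local Notation C := R[i].
Variable N : nat.
Local Notation M := 'M[C]_N.

(* standard basis vector e_m (1-based index m, row i <-> site i+1) *)
Definition basis_vec (m : nat) : 'cV[C]_N := \col_(i < N) ((i.+1 == m)%:R).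

Definition cinner (x y : 'cV[C]_N) : C := \sum_(i < N) (x i 0)^* * y i 0.

Definition projp (n : nat) : M := basis_vec n *m (map_mx conjc (basis_vec n))^T.

(* (h psi)(n) = -psi(n+1) - psi(n-1) + v(n) psi(n), Dirichlet b.c. *)
Definition ham (v : nat -> R) : M :=
  \matrix_(i < N, j < N)
    ( - ((j == i.+1 :> nat)%:R) - ((j.+1 == i :> nat)%:R)
      + (v i.+1)%:C * ((i == j :> nat)%:R)).

Definition lind (v : nat -> R) (ail aol air aor beta : R) (a : M) : M :=
  let h := ham v in
  let zl := (ail + aol)%:C in
  let zr := (air + aor)%:C in
  let Z := zl *: projp 1 + zr *: projp N in
  - 'i *: (h *m a - a *m h) - (Z *m a + a *m Z)
  + beta%:C *: ((\sum_(n < N) projp n.+1 *m a *m projp n.+1) - a).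

Definition climn (u : nat -> C) : C :=
  @Complex R (limn (fun n => complex.Re (u n))) (limn (fun n => complex.Im (u n))).

Definition semigroup (L : M -> M) (t : R) (a : M) : M :=
  \matrix_(i < N, j < N)
    climn (fun n => \sum_(k < n) ((t ^+ k / (k`!)%:R)%:C * (iter k L a) i j)).

Definition rint0 (g : R -> R) (T : R) : R :=
  Rintegral lebesgue_measure `[0, T] g.
Definition rimproper (g : R -> R) : R := lim (rint0 g T @[T --> +oo]).
Definition rimproper_cvg (g : R -> R) : Prop := cvg (rint0 g T @[T --> +oo]).

Definition cimproper (f : R -> C) : C :=
  @Complex R (rimproper (fun s => complex.Re (f s))) (rimproper (fun s => complex.Im (f s))).
Definition cimproper_cvg (f : R -> C) : Prop :=
  rimproper_cvg (fun s => complex.Re (f s)) /\ rimproper_cvg (fun s => complex.Im (f s)).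

Definition mimproper (F : R -> M) : M :=
  \matrix_(i < N, j < N) cimproper (fun s => F s i j).

Definition linv (L : M -> M) (b : M) : M :=
  vec_mx (mxvec b *m invmx (lin_mx L)).

Definition Rinf (v : nat -> R) (ail aol air aor beta : R) : M :=
  mimproper (fun s => semigroup (lind v ail aol air aor beta) s
                        ((2 * ail)%:C *: projp 1 + (2 * air)%:C *: projp N)).

Definition current (v : nat -> R) (ail aol air aor beta : R) : R :=
  2 * complex.Im (cinner (basis_vec 2) (Rinf v ail aol air aor beta *m basis_vec 1)).

End Model.

(* Main.v *)
Require Import Defs.
From HB Require Import structures.
From mathcomp Require Import all_boot all_order all_algebra.
From mathcomp Require Import all_classical all_reals all_analysis.
From mathcomp Require Import complex ring lra zify.
Set Implicit Arguments. Unset Strict Implicit. Unset Printing Implicit Defensive.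
Import Order.TTheory GRing.Theory Num.Theory.
Import numFieldNormedType.Exports.
Local Open Scope ring_scope.
Local Open Scope complex_scope.

(* [l 1 = -2 zl p_1 - 2 zr p_N] and [l R = -X] express both [1] and [R] through
   [A = l^-1 p_1] and [P = l^-1 p_N]; the (1,1) entry of [l R = -X], with [R]
   Hermitian, reads [J = 2 ail - 2 zl R_11], and eliminating [A_11] leaves a
   multiple of [P_11].

   Invertibility and convergence follow once every eigenvalue of [l] has negative
   real part. If [l a = lam a] then
   [Re lam * sum |a_ij|^2 = - sum d_ij |a_ij|^2] with [d_ij >= 0]; so if
   [Re lam >= 0] the first or the last row of [a] vanishes and [h a - a h = mu a],
   and since [h] is tridiagonal with nonzero off-diagonal entries the zero row
   spreads to all of [a].

   For the decay of the semigroup, Cayley-Hamilton makes the moments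
   [c_k = (l^k a)_ij] annihilated by the product of the [S - lam], [S] being the
   shift and [lam] running over eigenvalues of [l]. As [S] acts on
   [sum_k c_k t^k / k!] as d/dt, this sum solves nested scalar equations
   [y' = lam y + g] in which [g -> 0] forces [y -> 0]. *)

(** * Exponential generating functions of real sequences: derivative, integral and decay at
    infinity *)

Section ExponentialGeneratingFunction.
Local Open Scope classical_set_scope.
Context {R : realType}.
Implicit Types (r : nat -> R) (t : R).

(** [B] pairs the constant with the ratio. Only the ratio is required to be nonnegative; the bound
    at [k = 0] forces the constant to be so too. *)
Definition geometrically_bounded r :=
  exists2 B : R * R, 0 <= B.2 & forall k, `|r k| <= B.1 * B.2 ^+ k.

Definition egf r t : R := limn (pseries (fun k => r k / k`!%:R) t).

Lemma geometrically_bounded_shift r :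
  geometrically_bounded r -> geometrically_bounded (fun k => r k.+1).
Proof.
move=> [[K p] /= p0 rK]; exists (K * p, p) => //= k.
by rewrite -mulrA -exprS.
Qed.

(** Comparison with [K] times the exponential series at [p * |t|]. *)
Lemma is_cvg_egf r t : geometrically_bounded r ->
  cvgn (pseries (fun k => r k / k`!%:R) t).
Proof.
move=> [[K p] /= p0 rK]; apply: normed_cvg.
apply: (@series_le_cvg _ _ (K *: exp_coeff (p * `|t|))) => //=.
- move=> n; rewrite /= /exp_coeff /=.
  have K0 : 0 <= K by have := le_trans (normr_ge0 _) (rK 0%N); rewrite mulr1.
  by rewrite !mulr_ge0// ?invr_ge0// exprn_ge0// mulr_ge0.
- move=> n; rewrite /GRing.scale /= /exp_coeff/= !normrM normfV normrX.
  rewrite (ger0_norm (ler0n _ _)).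
  rewrite [leRHS](_ : _ = K * p ^+ n * ((n`!%:R)^-1 * `|t| ^+ n)); last first.
    by transitivity (K * ((p * `|t|) ^+ n / n`!%:R)); rewrite // exprMn; ring.
  by rewrite -mulrA ler_wpM2r// mulr_ge0// ?invr_ge0// exprn_ge0.
- by apply: is_cvg_seriesZ; exact: is_cvg_series_exp_coeff.
Qed.

(** Differentiating brings down a factor [k + 1], which turns [r k.+1 / (k + 1)!] into
    [r k.+1 / k!]. *)
Lemma is_derive_egf r t : geometrically_bounded r ->
  is_derive t (1 : R) (egf r) (egf (fun k => r k.+1) t).
Proof.
have diffsE s : pseries_diffs (fun k => s k / k`!%:R) =
    (fun k => s k.+1 / k`!%:R) :> (nat -> R).
  apply/funext => k; rewrite /pseries_diffs factS natrM invfM.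
  by rewrite mulrCA mulVKf.
move=> rB; have rB' := geometrically_bounded_shift rB.
rewrite /egf -diffsE; apply: (@pseries_snd_diffs _ _ (`|t| + 1)).
- exact: is_cvg_egf.
- by rewrite diffsE; exact: is_cvg_egf.
- by rewrite 2!diffsE; apply: is_cvg_egf; exact: geometrically_bounded_shift rB'.
- by rewrite [ltRHS]ger0_norm ?addr_ge0// ltrDl.
Qed.

Lemma egfD r s t : geometrically_bounded r -> geometrically_bounded s ->
  egf (fun k => r k + s k) t = egf r t + egf s t.
Proof.
move=> rB sB; rewrite /egf -limD; try exact: is_cvg_egf.
congr (limn _); apply/funext => n; rewrite fctE /pseries /series /=.
by rewrite -big_split/=; apply: eq_bigr => k _; rewrite -!mulrDl.
Qed.

Lemma egfZ a r t : geometrically_bounded r ->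
  egf (fun k => a * r k) t = a * egf r t.
Proof.
move=> rB; rewrite /egf -[RHS]limZr; last exact: is_cvg_egf.
congr (limn _); apply/funext => n; rewrite /pseries /series /=.
transitivity (a * \sum_(0 <= k < n) r k / k`!%:R * t ^+ k) => //.
by rewrite mulr_sumr; apply: eq_bigr => k _; rewrite !mulrA.
Qed.

Lemma egf_at0 r : egf r 0 = r 0%N.
Proof.
(* The shift skips the empty partial sum; all later ones equal [r 0]. *)
rewrite /egf; apply/cvg_lim => //; rewrite -(cvg_shiftS); apply: cvg_near_cst.
near=> n; rewrite /pseries /series/= big_nat_recl//= big1 ?addr0.
  by rewrite expr0 mulr1 fact0 divr1.
by move=> i _; rewrite exprS mul0r mulr0.
Unshelve. all: end_near. Qed.

Lemma Rintegral_egf r T : geometrically_bounded r -> 0 < T ->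
  rint0 (egf (fun k => r k.+1)) T = egf r T - r 0%N.
Proof.
move=> rB T0.
have cont s : geometrically_bounded s -> continuous (egf s).
  move=> sB x; apply/differentiable_continuous/derivable1_diffP.
  exact: (@ex_derive _ _ _ _ _ _ _ (is_derive_egf x sB)).
rewrite /rint0 /Rintegral (@continuous_FTC2 _ _ (egf r))//; last first.
- by move=> x _; rewrite derive1E (@derive_val _ _ _ _ _ _ _ (is_derive_egf x rB)).
- split.
  + by move=> x _; exact: (@ex_derive _ _ _ _ _ _ _ (is_derive_egf x rB)).
  + exact/cvg_at_right_filter/cont.
  + exact/cvg_at_left_filter/cont.
- apply: continuous_subspaceT; apply: cont; exact: geometrically_bounded_shift.
- by rewrite egf_at0.
Qed.

(** Once [g <= mu * (e / 2)], the excess of [u] over [e / 2] decays at least like [expR (- mu * t)],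
    so [u] ends up below [e]. *)
Lemma gronwall_decay (u g : R -> R) (du : R -> R) (mu : R) : 0 < mu ->
  (forall t, 0 <= u t) ->
  (forall t, is_derive t (1 : R) u (du t)) ->
  (forall t, du t <= - mu * u t + g t) ->
  g t @[t --> +oo] --> 0 -> u t @[t --> +oo] --> 0.
Proof.
move=> mu0 u0 duD duE g0; apply/cvgr0Pnorm_le => e e0.
have [T0 [_ gT0]] : \forall t \near +oo, g t <= mu * (e / 2).
  move/cvgr0Pnorm_le : g0 => /(_ (mu * (e / 2))); rewrite mulr_gt0 ?divr_gt0//.
  move=> /(_ isT); apply: filterS => t; exact: le_trans (ler_norm _).
set T := T0 + 1.
(* [w] is nonincreasing past [T] because [g <= mu * (e / 2)] there. *)
pose w t := (u t - e / 2) * expR (mu * t).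
pose dw t := (du t + mu * (u t - e / 2)) * expR (mu * t).
have wE t : is_derive t (1 : R) w (dw t).
  have ude := duD t.
  have ede : is_derive t (1 : R) (fun s => expR (mu * s)) (mu * expR (mu * t)).
    have mde : is_derive t (1 : R) ( *%R mu) mu.
      by apply: is_derive_eq; rewrite /GRing.scale/= mulr1.
    have := is_derive1_comp (is_derive_expR (mu * t)) mde.
    by rewrite mulrC.
  have sde : is_derive t (1 : R) (fun s => u s - e / 2) (du t).
    by apply: is_derive_eq; rewrite oppr0 addr0.
  apply: is_derive_eq.
  rewrite /dw /GRing.scale /=; ring.
have wle t : T < t -> w t <= w T.
  move=> Tt.
  apply: (@ler0_derive1_le_cc _ w T t) => //; rewrite ?in_itv/= ?lexx ?(ltW Tt)//.
  - move=> x; rewrite in_itv/= => /andP[Tx _].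
    rewrite derive1E (@derive_val _ _ _ _ _ _ _ (wE x)) /dw.
    rewrite pmulr_lle0 ?expR_gt0//.
    have := gT0 x (lt_trans _ Tx); rewrite ltrDl ltr01 => /(_ isT).
    have := duE x; lra.
  - by apply: derivable_within_continuous => x _; case: (wE x).
near=> t.
have Tt : T < t by near: t; apply: nbhs_pinfty_gt; exact: num_real.
have t0 : 0 < t by near: t; apply: nbhs_pinfty_gt; exact: num_real.
(* This makes [w T <= e / 2 * (mu * t)]; since [mu * t <= expR (mu * t)], dividing [w t <= w T] by
   the exponential gives [u t - e / 2 <= e / 2]. *)
have tw : `|w T| / (mu * (e / 2)) <= t by near: t; apply: nbhs_pinfty_ge; exact: num_real.
have := wle t Tt; rewrite ler_pdivrMr ?mulr_gt0 ?divr_gt0// in tw.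
rewrite ger0_norm// /w => wt.
have {wt} : (u t - e / 2) * expR (mu * t) <= e / 2 * (mu * t).
  by rewrite (le_trans wt)// (le_trans (ler_norm _))// (le_trans tw)//; nra.
have : mu * t <= expR (mu * t) by rewrite (le_trans _ (expR_ge1Dx _))// lerDr.
have := expR_gt0 (mu * t).
move: (expR _) => E E0 muE H.
have : (u t - e / 2) * E <= e / 2 * E.
  by rewrite (le_trans H)// ler_wpM2l// ltW// divr_gt0.
by rewrite ler_pM2r//; lra.
Unshelve. all: end_near. Qed.

Lemma geometric_weaken (f : nat -> R) (K p L q : R) : 0 <= p -> K <= L -> p <= q ->
  (forall k, `|f k| <= K * p ^+ k) -> forall k, `|f k| <= L * q ^+ k.
Proof.
move=> p0 KL pq fK k; rewrite (le_trans (fK k))//.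
have K0 : 0 <= K by have := le_trans (normr_ge0 _) (fK 0%N); rewrite mulr1.
rewrite ler_pM// ?exprn_ge0//.
by rewrite lerXn2r// nnegrE// (le_trans p0).
Qed.

Lemma geometrically_bounded_common (f g : nat -> R) :
  geometrically_bounded f -> geometrically_bounded g ->
  exists K p, [/\ 0 <= K, 0 <= p, forall k, `|f k| <= K * p ^+ k
    & forall k, `|g k| <= K * p ^+ k].
Proof.
move=> [[K p] /= p0 fK] [[L q] /= q0 gL].
exists (Num.max K L), (Num.max p q); split.
- have := le_trans (normr_ge0 _) (fK 0%N); rewrite mulr1 => K0.
  by rewrite le_max K0.
- by rewrite le_max p0.
- by apply: geometric_weaken fK; rewrite // le_max lexx.
- by apply: geometric_weaken gL; rewrite // le_max lexx orbT.
Qed.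

Lemma geometrically_boundedD (f g : nat -> R) :
  geometrically_bounded f -> geometrically_bounded g ->
  geometrically_bounded (fun k => f k + g k).
Proof.
move=> fB gB; have [K [p [K0 p0 fK gK]]] := geometrically_bounded_common fB gB.
exists (K + K, p) => //= k; rewrite mulrDl.
by rewrite (le_trans (ler_normD _ _))// lerD.
Qed.

Lemma geometrically_boundedZ (c : R) (f : nat -> R) :
  geometrically_bounded f -> geometrically_bounded (fun k => c * f k).
Proof.
move=> [[K p] /= p0 rK]; exists (`|c| * K, p) => //= k.
by rewrite normrM -mulrA ler_wpM2l.
Qed.

(** The two recurrences are the real and imaginary parts of [c k.+1 = lam * c k + d k] with
    [lam = a + i b], [c = x + i y] and [d = f + i g]. *)
Lemma geometrically_bounded_recurrence (x y f g : nat -> R) (a b : R) :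
  geometrically_bounded f -> geometrically_bounded g ->
  (forall k, x k.+1 = a * x k - b * y k + f k) ->
  (forall k, y k.+1 = b * x k + a * y k + g k) ->
  geometrically_bounded x /\ geometrically_bounded y.
Proof.
move=> fB gB xE yE; have [K [p [K0 p0 fK gK]]] := geometrically_bounded_common fB gB.
(* [B] dominates the initial values and the forcing constant. The ratio [rho] is at least [p], which
   covers the forcing, and at least [|a| + |b| + 1], the most by which one step can enlarge the
   bound. *)
pose B := `|x 0%N| + `|y 0%N| + K.
pose rho := `|a| + `|b| + 1 + p.
have KB : K <= B by rewrite lerDr addr_ge0.
have prho : p <= rho by rewrite lerDr !addr_ge0.
have rho0 : 0 <= rho by rewrite (le_trans p0).
have Brho k : 0 <= B * rho ^+ k by rewrite mulr_ge0 ?exprn_ge0// (le_trans K0).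
have {}fK := geometric_weaken p0 KB prho fK.
have {}gK := geometric_weaken p0 KB prho gK.
have step k (u v w c d : R) : `|u| <= B * rho ^+ k -> `|v| <= B * rho ^+ k ->
    `|w| <= B * rho ^+ k -> `|c| + `|d| + 1 <= rho ->
    `|c * u + d * v + w| <= B * rho ^+ k.+1.
  move=> uB vB wB cd.
  rewrite (le_trans (ler_normD _ _))//.
  rewrite (le_trans (lerD (ler_normD _ _) (lexx _)))// !normrM.
  rewrite exprSr mulrA [leRHS]mulrC.
  apply: le_trans (ler_wpM2r (Brho k) cd).
  move: (B * rho ^+ k) (Brho k) uB vB wB => Z Z0 uB vB wB.
  by rewrite !mulrDl mul1r !lerD// ler_wpM2l.
have xyB k : `|x k| <= B * rho ^+ k /\ `|y k| <= B * rho ^+ k.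
  elim: k => [|k [xk yk]].
    by rewrite !expr0 !mulr1 /B -!addrA lerDl addrCA lerDl !addr_ge0.
  rewrite xE yE -mulNr; split; apply: step => //.
    by rewrite normrN lerDl.
  by rewrite [`|b| + _]addrC lerDl.
by split; exists (B, rho) => // k; case: (xyB k).
Qed.

(** Let [q] be the squared modulus of the complex generating function. The rotation by [b] cancels
    in its derivative, leaving [2 a q] plus a cross term with the forcing; Young's inequality
    absorbs the latter at the cost of half the decay rate, so [gronwall_decay] applies with
    [mu = - a]. *)
Lemma egf_recurrence_cvg0 (x y f g : nat -> R) (a b : R) : a < 0 ->
  geometrically_bounded f -> geometrically_bounded g ->
  (forall k, x k.+1 = a * x k - b * y k + f k) ->
  (forall k, y k.+1 = b * x k + a * y k + g k) ->
  egf f t @[t --> +oo] --> 0 -> egf g t @[t --> +oo] --> 0 ->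
  egf x t @[t --> +oo] --> 0 /\ egf y t @[t --> +oo] --> 0.
Proof.
move=> a0 fB gB xE yE f0 g0.
have [xB yB] := geometrically_bounded_recurrence fB gB xE yE.
pose q t := egf x t ^+ 2 + egf y t ^+ 2.
pose dx t := a * egf x t - b * egf y t + egf f t.
pose dy t := b * egf x t + a * egf y t + egf g t.
have dxE t : is_derive t (1 : R) (egf x) (dx t).
  suff -> : dx t = egf (fun k => x k.+1) t by exact: is_derive_egf.
  rewrite (_ : (fun k => _) = fun k => a * x k + (- b) * y k + f k); last first.
    by apply/funext => k; rewrite xE mulNr.
  rewrite !egfD ?egfZ ?mulNr//; do ?[exact: geometrically_boundedZ].
  by apply: geometrically_boundedD; exact: geometrically_boundedZ.
have dyE t : is_derive t (1 : R) (egf y) (dy t).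
  suff -> : dy t = egf (fun k => y k.+1) t by exact: is_derive_egf.
  rewrite (_ : (fun k => _) = fun k => b * x k + a * y k + g k); last first.
    by apply/funext => k; rewrite yE.
  rewrite !egfD ?egfZ//; do ?[exact: geometrically_boundedZ].
  by apply: geometrically_boundedD; exact: geometrically_boundedZ.
have q0 : q t @[t --> +oo] --> 0.
  apply: (@gronwall_decay q (fun t => (- a)^-1 * (egf f t ^+ 2 + egf g t ^+ 2))
    (fun t => 2 * (egf x t * dx t + egf y t * dy t)) (- a)).
  - by rewrite oppr_gt0.
  - by move=> t; rewrite addr_ge0 ?sqr_ge0.
  - move=> t; apply: is_derive_eq; rewrite /GRing.scale /=; ring.
  - move=> t; rewrite /dx /dy /q opprK.
    move: (egf x t) (egf y t) (egf f t) (egf g t) => X Y F G.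
    (* Young's inequality with weight [-a] *)
    have young (u w : R) : 2 * (u * w) <= (- a) * u ^+ 2 + (- a)^-1 * w ^+ 2.
      rewrite -subr_ge0.
      rewrite [leRHS](_ : _ = (- a)^-1 * (a * u + w) ^+ 2).
        by rewrite mulr_ge0 ?invr_ge0 ?sqr_ge0// oppr_ge0 ltW.
      by field; rewrite ?oppr_eq0 lt_eqF.
    have := young X F; have := young Y G; nra.
  - rewrite -[X in _ --> X](mulr0 (- a)^-1) -[X in _ * X](addr0 0).
    apply: cvgMr; apply: cvgD; rewrite -[X in _ --> X](mulr0 0).
    + exact: cvgM.
    + exact: cvgM.
by split; apply/cvgr0Pnorm_le => e e0;
  move/cvgr0Pnorm_le : q0 => /(_ (e ^+ 2) (exprn_gt0 _ e0));
  apply: filterS => t; rewrite ger0_norm ?addr_ge0 ?sqr_ge0// => qe;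
  rewrite -(@ler_pXn2r _ 2)// ?nnegrE ?(ltW e0)// real_normK ?num_real//;
  rewrite (le_trans _ qe)// ?lerDl ?lerDr sqr_ge0.
Qed.
End ExponentialGeneratingFunction.

(** * The semigroup generated by a linear map on matrices with spectrum in the open left
    half-plane *)

Section MatrixSemigroup.
Local Open Scope classical_set_scope.
Context {R : realType}.
Local Notation C := R[i].

(** The characteristic polynomial splits over [C], and Cayley-Hamilton applies. The product is
    written as a fold so that later inductions peel off one factor [A - lam] at a time. *)
Lemma split_annihilator n (A : 'M[C]_n) :
  exists2 rs : seq C, all (eigenvalue A) rs &
    forall u : 'rV_n, foldl (fun w lam => w *m A - lam *: w) u rs = 0.
Proof.
case: n A => [|n] A; first by exists [::] => // u; rewrite /= thinmx0.
have [rs rsE] := closed_field_poly_normal (char_poly A).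
move: rsE; rewrite (monicP (char_poly_monic A)) scale1r => rsE.
exists rs.
  by apply/allP => lam lamrs; rewrite eigenvalue_root_char rsE root_prod_XsubC.
have foldE u : foldl (fun w lam => w *m A - lam *: w) u rs =
    u *m horner_mx A (\prod_(lam <- rs) ('X - lam%:P)).
  elim: (rs) u => [|lam s IHs] u /=; first by rewrite big_nil rmorph1 mulmx1.
  rewrite IHs big_cons rmorphM -mulmxE mulmxA; congr (_ *m _).
  by rewrite rmorphB/= horner_mx_X horner_mx_C mulmxBr mul_mx_scalar.
by move=> u; rewrite foldE -rsE Cayley_Hamilton mulmx0.
Qed.

(** Induction on [rs]: the sequence [c k.+1 - lam * c k] is annihilated by the remaining factors, so
    its generating function decays, and it serves as the forcing in the recurrence for [c]. *)
Lemma egf_annihilated_cvg0 (rs : seq C) (c : nat -> C) :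
  all (fun lam => complex.Re lam < 0) rs ->
  (forall k, foldl (fun d lam => fun k => d k.+1 - lam * d k) c rs k = 0) ->
  [/\ geometrically_bounded (fun k => complex.Re (c k)),
      geometrically_bounded (fun k => complex.Im (c k)),
      egf (fun k => complex.Re (c k)) t @[t --> +oo] --> 0 &
      egf (fun k => complex.Im (c k)) t @[t --> +oo] --> 0].
Proof.
elim: rs c => [|lam rs IHrs] c /=.
  move=> _ c0.
  have zB : geometrically_bounded (fun=> 0 : R).
    by exists (0, 0) => //= k; rewrite normr0 mul0r.
  have egf0 t : egf (fun=> 0 : R) t = 0.
    by have := egfZ 0 t zB; rewrite (_ : (fun=> 0 * 0) = fun=> 0) ?mul0r.
  have -> : (fun k => complex.Re (c k)) = fun=> 0 by apply/funext => k; rewrite c0.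
  have -> : (fun k => complex.Im (c k)) = fun=> 0 by apply/funext => k; rewrite c0.
  by split => //; under eq_cvg do rewrite egf0; exact: cvg_cst.
move=> /andP[lam0 rs0] /(IHrs _ rs0)[reB imB re0 im0].
have reE k : complex.Re (c k.+1) = complex.Re lam * complex.Re (c k)
    - complex.Im lam * complex.Im (c k) + complex.Re (c k.+1 - lam * c k).
  by case: (c k.+1) (c k) (lam) => [x y] [x' y'] [a b] /=; ring.
have imE k : complex.Im (c k.+1) = complex.Im lam * complex.Re (c k)
    + complex.Re lam * complex.Im (c k) + complex.Im (c k.+1 - lam * c k).
  by case: (c k.+1) (c k) (lam) => [x y] [x' y'] [a b] /=; ring.
have [xB yB] := geometrically_bounded_recurrence reB imB reE imE.
have [x0 y0] := egf_recurrence_cvg0 lam0 reB imB reE imE re0 im0.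
by split.
Qed.

Variables (N : nat) (L : {linear 'M[C]_N -> 'M[C]_N}).
Hypothesis L_stable : forall lam a, a != 0 -> L a = lam *: a -> complex.Re lam < 0.

(** A nonzero kernel element would be an eigenvector for [0], whose real part is not negative. *)
Lemma stable_unitmx : lin_mx L \in unitmx.
Proof.
rewrite -row_free_unit -kermx_eq0; apply/rowV0P => u /sub_kermxP.
rewrite -[u]vec_mxK mul_vec_lin => /eqP; rewrite mxvec_eq0 => /eqP Lu0.
have [->|u0] := eqVneq (vec_mx u) 0; first by rewrite linear0.
have := @L_stable 0 _ u0; rewrite Lu0 scale0r => /(_ erefl).
by rewrite ltxx.
Qed.

Lemma linvK (a : 'M[C]_N) : L (linv L a) = a.
Proof.
apply: (can_inj mxvecK); rewrite -mul_vec_lin /linv vec_mxK -mulmxA.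
by rewrite mulVmx ?mulmx1// stable_unitmx.
Qed.

Lemma linv_unique (a b : 'M[C]_N) : L a = b -> a = linv L b.
Proof.
by move=> <-; rewrite /linv -mul_vec_lin mulmxK ?mxvecK// stable_unitmx.
Qed.

Lemma stable_iter_cvg0 (a : 'M[C]_N) i j :
  [/\ geometrically_bounded (fun k => complex.Re (iter k L a i j)),
      geometrically_bounded (fun k => complex.Im (iter k L a i j)),
      egf (fun k => complex.Re (iter k L a i j)) t @[t --> +oo] --> 0 &
      egf (fun k => complex.Im (iter k L a i j)) t @[t --> +oo] --> 0].
Proof.
have [rs /allP rsP rs0] := split_annihilator (lin_mx L).
apply: (@egf_annihilated_cvg0 rs).
  apply/allP => lam /rsP /eigenvalueP[u uL u0].
  apply: (@L_stable lam (vec_mx u)); first by rewrite vec_mx_eq0.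
  by apply: (can_inj mxvecK); rewrite -mul_vec_lin vec_mxK uL linearZ/= vec_mxK.
(* Shifting the moments of [b] amounts to replacing [b] by [L b], so the factors [S - lam] on
   moments become [L - lam] on matrices. *)
have -> : foldl (fun d lam => fun k => d k.+1 - lam * d k)
      (fun k => iter k L a i j) rs =
    fun k => iter k L (foldl (fun b lam => L b - lam *: b) a rs) i j.
  elim: (rs) a => [//|lam s IHs] b /=; rewrite -IHs; congr foldl.
  apply/funext => k; rewrite -iterS iterSr.
  suff -> : iter k L (L b - lam *: b) = iter k L (L b) - lam *: iter k L b.
    by rewrite !mxE.
  by elim: k => //= k ->; rewrite linearB linearZ.
have -> : foldl (fun b lam => L b - lam *: b) a rs = 0.
  apply: (can_inj mxvecK); rewrite linear0 -[RHS](rs0 (mxvec a)).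
  elim: (rs) a => [//|lam s IHs] b /=.
  by rewrite IHs linearB linearZ/= mul_vec_lin.
move=> k; suff -> : iter k L 0 = 0 by rewrite mxE.
by elim: k => //= k ->; rewrite linear0.
Qed.

(** Both sides are limits of the same partial sums, as [t] is real and [climn] treats real and
    imaginary parts separately. *)
Lemma semigroupE (a : 'M[C]_N) i j t :
  semigroup L t a i j = Complex (egf (fun k => complex.Re (iter k L a i j)) t)
                                (egf (fun k => complex.Im (iter k L a i j)) t).
Proof.
rewrite mxE /climn; congr Complex; congr (limn _); apply/funext => n;
  rewrite /pseries /series/= big_mkord.
- rewrite (raddf_sum (@complex.Re R : Rcomplex R -> R)); apply: eq_bigr => k _.
  by case: (iter k L a i j) => x y /=; rewrite mul0r subr0; ring.
- rewrite (raddf_sum (@complex.Im R : Rcomplex R -> R)); apply: eq_bigr => k _.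
  by case: (iter k L a i j) => x y /=; rewrite mul0r addr0; ring.
Qed.

(** With [b = linv L a], the moments of [a] are those of [b] shifted by one. Hence the entries of
    [semigroup L t b] are primitives of those of [semigroup L t a]; they vanish at infinity and
    equal the entries of [b] at [0]. *)
Lemma rint0_semigroup_cvg (a : 'M[C]_N) i j :
  (rint0 (fun t => complex.Re (semigroup L t a i j)) T @[T --> +oo] -->
    - complex.Re (linv L a i j)) /\
  (rint0 (fun t => complex.Im (semigroup L t a i j)) T @[T --> +oo] -->
    - complex.Im (linv L a i j)).
Proof.
have [reB imB re0 im0] := stable_iter_cvg0 (linv L a) i j.
have shiftE k : iter k L a = iter k.+1 L (linv L a) by rewrite iterSr linvK.
have primitive_cvg (r : nat -> R) (f : R -> R) : geometrically_bounded r ->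
    egf r t @[t --> +oo] --> 0 -> f = egf (fun k => r k.+1) ->
    rint0 f T @[T --> +oo] --> - r 0%N.
  move=> rB r0 ->.
  have : egf r t - r 0%N @[t --> +oo] --> 0 - r 0%N by apply: cvgB => //; exact: cvg_cst.
  rewrite sub0r; apply: cvg_trans; apply: near_eq_cvg; near=> T.
  rewrite Rintegral_egf//; near: T; apply: nbhs_pinfty_gt; exact: num_real.
split; [apply: primitive_cvg reB re0 _|apply: primitive_cvg imB im0 _];
  apply/funext => t; rewrite semigroupE /=; congr egf;
  by apply/funext => k; rewrite shiftE.
Unshelve. all: end_near. Qed.

Lemma cimproper_cvg_semigroup (a : 'M[C]_N) i j :
  cimproper_cvg (fun t => semigroup L t a i j).
Proof.
by have [re im] := rint0_semigroup_cvg a i j; split; [exact: cvgP re|exact: cvgP im].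
Qed.

Lemma cimproper_semigroup (a : 'M[C]_N) i j :
  cimproper (fun t => semigroup L t a i j) = - linv L a i j.
Proof.
have [re im] := rint0_semigroup_cvg a i j.
rewrite /cimproper /rimproper (cvg_lim _ re)// (cvg_lim _ im)//.
by case: (linv L a i j).
Qed.

End MatrixSemigroup.

(** * Entrywise form, spectrum and symmetries of the Lindbladian *)

Section Lindbladian.
Context {R : realType}.
Local Notation C := R[i].

(** If rows [0] to [n] of [a] vanish, row [n] of the equation reduces to the entry of [H] at
    [(n, n.+1)] times row [n.+1] of [a]. The right factor [B] is independent of [H] so that the rows
    alone can be reversed. *)
Lemma hessenberg_intertwiner_eq0 (F : fieldType) N (H B a : 'M[F]_N) (mu : F) :
  (forall i j : 'I_N, (i.+1 < j)%N -> H i j = 0) ->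
  (forall i j : 'I_N, j = i.+1 :> nat -> H i j != 0) ->
  H *m a - a *m B = mu *: a ->
  (forall i j : 'I_N, i = 0 :> nat -> a i j = 0) -> a = 0.
Proof.
move=> H0 H1 Ha a0.
suff rows0 n (i j : 'I_N) : (i <= n)%N -> a i j = 0.
  by apply/matrixP => i j; rewrite (rows0 i) ?mxE.
elim: n i j => [|n IHn] i j; first by rewrite leqn0 => /eqP; exact: a0.
rewrite leq_eqVlt => /predU1P[iE|]; last by rewrite ltnS; exact: IHn.
have nN : (n < N)%N by rewrite (leq_trans _ (ltn_ord i))// iE.
move/matrixP : Ha => /(_ (Ordinal nN) j); rewrite !mxE.
rewrite [X in _ - X]big1 => [|k _]; last by rewrite IHn ?mul0r.
rewrite (IHn (Ordinal nN) j)// mulr0 subr0 (bigD1 i)//= big1 ?addr0.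
  by move/eqP; rewrite mulf_eq0 (negbTE (H1 _ _ _))//= => /eqP.
move=> k ki; have [kn|nk] := leqP k n; first by rewrite IHn ?mulr0.
rewrite H0 ?mul0r//= ltn_neqAle nk andbT -iE eq_sym.
by apply: contra_neq ki => /ord_inj.
Qed.

Lemma projpE N n : projp R N n = diag_mx (\row_(i < N) (i.+1 == n)%:R).
Proof.
apply/matrixP => i j; rewrite !mxE big_ord1 !mxE conjc_nat.
have [->|ij] := eqVneq i j; first by case: eqP => _; rewrite ?mulr1n ?mulr1 ?mulr0.
rewrite mulr0n; case: eqP => iE; rewrite ?mul0r// mul1r; case: eqP => // jE.
by case/eqP: ij; apply/ord_inj/succn_inj; rewrite iE jE.
Qed.

Lemma cinner_basis_mulmx N (a : 'M[C]_N) (i j : 'I_N) :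
  cinner (basis_vec R N i.+1) (a *m basis_vec R N j.+1) = a i j.
Proof.
rewrite /cinner (bigD1 i)//= big1 ?addr0 => [|k ki].
  rewrite !mxE eqxx rmorph_nat mul1r (bigD1 j)//= big1 ?addr0 => [|k kj].
    by rewrite mxE eqxx mulr1.
  by rewrite mxE eqSS (inj_eq val_inj) (negbTE kj) mulr0.
by rewrite mxE eqSS (inj_eq val_inj) (negbTE ki) rmorph_nat mul0r.
Qed.

Variables (N : nat) (v : nat -> R) (ail aol air aor beta : R).
Local Notation l := (@lind R N v ail aol air aor beta).
Local Notation h := (@ham R N v).

Definition ham_comm (a : 'M[C]_N) := h *m a - a *m h.

(** The diagonal of [zeta_l p_1 + zeta_r p_N], with site [i.+1] stored at index [i]. *)
Definition site_rate (i : 'I_N) : R :=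
  (ail + aol) * (i == 0 :> nat)%:R + (air + aor) * (i.+1 == N)%:R.

(** The anticommutator and the dephasing term are diagonal in the matrix units: together they
    multiply entry [(i, j)] by [- damping i j]. Dephasing spares the diagonal. *)
Definition damping (i j : 'I_N) : R :=
  site_rate i + site_rate j + beta * (i != j)%:R.

Lemma lindE a i j :
  l a i j = - 'i * ham_comm a i j - (damping i j)%:C * a i j.
Proof.
rewrite /lind -/(ham_comm a) !projpE mulmxDl mulmxDr -!scalemxAl -!scalemxAr.
rewrite !mul_diag_mx !mul_mx_diag.
have -> : \sum_(n < N) projp R N n.+1 *m a *m projp R N n.+1 =
    \matrix_(i, j) (a i j *+ (i == j)).
  apply/matrixP => p q; rewrite summxE mxE (bigD1 p)//= big1 => [|k kp].
    rewrite !projpE mul_diag_mx mul_mx_diag !mxE eqxx mul1r addr0.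
    by rewrite eqSS (inj_eq val_inj) eq_sym; case: eqP => _; rewrite ?mulr1 ?mulr0.
  rewrite !projpE mul_diag_mx mul_mx_diag !mxE eqSS (inj_eq val_inj).
  by rewrite eq_sym (negbTE kp) !mul0r.
move: (ham_comm a) => c; rewrite !mxE !eqSS /damping /site_rate.
rewrite !(rmorphD, rmorphM, rmorph_nat)/=.
by case: (i == j) => /=; rewrite ?mulr1n ?mulr0n; ring.
Qed.

Lemma lind_is_linear : linear l.
Proof.
move=> k a b; apply/matrixP => i j.
have commE : ham_comm (k *: a + b) = k *: ham_comm a + ham_comm b.
  rewrite /ham_comm mulmxDr mulmxDl -scalemxAr -scalemxAl scalerBr.
  by rewrite opprD addrACA.
rewrite [RHS]mxE [in RHS]mxE !lindE commE.
move: (ham_comm a) (ham_comm b) => p q; rewrite !mxE; ring.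
Qed.

HB.instance Definition _ := GRing.isLinear.Build C 'M[C]_N 'M[C]_N _ l lind_is_linear.

Lemma ham_sym i j : h i j = h j i.
Proof.
rewrite !mxE (eq_sym (j.+1 : nat)) [i.+1 == j :> nat]eq_sym [j == i :> nat]eq_sym.
case: (eqVneq (i : nat) j) => [->|_]; first by ring.
by rewrite !mulr0; ring.
Qed.

Lemma ham_real i j : conjc (h i j) = h i j.
Proof.
rewrite !mxE !(rmorphD, rmorphB, rmorphM, rmorphN)/=.
by rewrite !conjc_nat oppr0.
Qed.

Lemma site_rate_ge0 i : 0 <= ail + aol -> 0 <= air + aor -> 0 <= site_rate i.
Proof. by move=> zl0 zr0; rewrite addr_ge0// mulr_ge0. Qed.

Lemma damping_ge0 i j : 0 <= ail + aol -> 0 <= air + aor -> 0 <= beta ->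
  0 <= damping i j.
Proof. by move=> *; rewrite !addr_ge0 ?site_rate_ge0// mulr_ge0. Qed.

(** Commutation with the real symmetric [h] is self-adjoint for the Hilbert-Schmidt inner
    product. *)
Lemma ham_comm_form_real (a : 'M[C]_N) :
  conjc (\sum_i \sum_j conjc (a i j) * ham_comm a i j) =
  \sum_i \sum_j conjc (a i j) * ham_comm a i j.
Proof.
have formE : \sum_i \sum_j conjc (a i j) * ham_comm a i j =
    (\sum_i \sum_j \sum_k conjc (a i j) * (h i k * a k j)) -
    (\sum_i \sum_j \sum_k conjc (a i j) * (a i k * h k j)).
  rewrite -sumrB; apply: eq_bigr => i _; rewrite -sumrB; apply: eq_bigr => j _.
  by rewrite !mxE mulrBr !mulr_sumr.
have sumJ (F G : 'I_N -> 'I_N -> 'I_N -> C) :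
    (forall i j k, conjc (F i j k) = G i j k) ->
    conjc (\sum_i \sum_j \sum_k F i j k) = \sum_i \sum_j \sum_k G i j k.
  move=> FG; rewrite rmorph_sum; apply: eq_bigr => i _.
  rewrite rmorph_sum; apply: eq_bigr => j _.
  by rewrite rmorph_sum; apply: eq_bigr => k _; exact: FG.
rewrite formE rmorphB; congr (_ - _).
- transitivity (\sum_i \sum_j \sum_k conjc (a k j) * (h k i * a i j)).
    apply: sumJ => i j k; rewrite !rmorphM/= conjcK ham_real ham_sym; ring.
  rewrite exchange_big/= [RHS]exchange_big/=; apply: eq_bigr => j _.
  by rewrite exchange_big.
- transitivity (\sum_i \sum_j \sum_k conjc (a i k) * (a i j * h j k)).
    apply: sumJ => i j k; rewrite !rmorphM/= conjcK ham_real ham_sym; ring.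
  by apply: eq_bigr => i _; rewrite exchange_big.
Qed.

(** Pair [l a = lam *: a] with [a] and add the conjugate equation: the form [S] is real, so the
    commutator terms cancel. What remains is [2 Re lam] times the squared norm, which is
    nonnegative, equal to minus twice a sum of nonnegative terms; each term is therefore zero. *)
Lemma nondecaying_eigenvector_eq0 (lam : C) (a : 'M[C]_N) :
  0 <= ail + aol -> 0 <= air + aor -> 0 <= beta ->
  l a = lam *: a -> 0 <= complex.Re lam ->
  forall i j, damping i j != 0 -> a i j = 0.
Proof.
move=> zl0 zr0 b0 laE lam0.
pose n2 i j := conjc (a i j) * a i j.
have n20 i j : 0 <= n2 i j by rewrite /n2 mulrC mulcJ_ge0.
pose S := \sum_i \sum_j conjc (a i j) * ham_comm a i j.
have SE : lam * (\sum_i \sum_j n2 i j) =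
    - 'i * S - \sum_i \sum_j (damping i j)%:C * n2 i j.
  rewrite !mulr_sumr -sumrB; apply: eq_bigr => i _.
  rewrite !mulr_sumr -sumrB; apply: eq_bigr => j _.
  move/matrixP : laE => /(_ i j); rewrite lindE [RHS]mxE => e.
  by rewrite /n2 mulrCA -e; ring.
have n2J i j : conjc (n2 i j) = n2 i j by rewrite /n2 rmorphM/= conjcK mulrC.
have sumJ (f : 'I_N -> 'I_N -> C) : (forall i j, conjc (f i j) = f i j) ->
    conjc (\sum_i \sum_j f i j) = \sum_i \sum_j f i j.
  move=> fJ; rewrite rmorph_sum; apply: eq_bigr => i _.
  by rewrite rmorph_sum; apply: eq_bigr => j _; exact: fJ.
have SEJ : conjc lam * (\sum_i \sum_j n2 i j) =
    'i * S - \sum_i \sum_j (damping i j)%:C * n2 i j.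
  have := congr1 (@conjc R) SE.
  rewrite rmorphM/= (sumJ n2)// => ->.
  rewrite rmorphB/= rmorphM/= ham_comm_form_real sumJ; last first.
    by move=> i j; rewrite rmorphM/= n2J oppr0.
  by congr (_ * _ - _); apply/eqP; rewrite eq_complex /= oppr0 opprK !eqxx.
have sum0 : \sum_i \sum_j ((damping i j)%:C * n2 i j) = 0.
  apply/eqP; rewrite eq_le; apply/andP; split; last first.
    apply: sumr_ge0 => i _; apply: sumr_ge0 => j _.
    by rewrite mulr_ge0// ler0c damping_ge0.
  rewrite -oppr_ge0.
  have : (lam + conjc lam) * (\sum_i \sum_j n2 i j) =
      - 2 * \sum_i \sum_j (damping i j)%:C * n2 i j.
    rewrite mulrDl SE SEJ; ring.
  rewrite addcJ -mulrA mulNr -mulrN => /(mulfI _) <-; last by rewrite pnatr_eq0.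
  rewrite mulr_ge0 ?ler0c//; apply: sumr_ge0 => i _; exact: sumr_ge0.
move=> i j dij; apply/eqP; move/eqP: sum0.
rewrite psumr_eq0 => [/allP/(_ i (mem_index_enum _))|p _]; last first.
  by apply: sumr_ge0 => q _; rewrite mulr_ge0// ler0c damping_ge0.
rewrite /= psumr_eq0 => [/allP/(_ j (mem_index_enum _))|q _]; last first.
  by rewrite mulr_ge0// ler0c damping_ge0.
rewrite /= /n2 !mulf_eq0 conjc_eq0 orbb => /orP[|//].
by rewrite -[0]/(0%:C) (inj_eq (@complexI R)) (negbTE dij).
Qed.

Lemma ham_upper_eq0 (i j : 'I_N) : (i.+1 < j)%N -> h i j = 0.
Proof.
move=> ij; rewrite mxE.
rewrite (gtn_eqF ij) (ltn_eqF (ltn_trans (ltnSn i) ij)).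
rewrite [j.+1 == i]gtn_eqF ?mulr0 ?oppr0 ?addr0//.
by rewrite (leq_trans _ (leqnSn j))// (leq_trans _ ij).
Qed.

Lemma ham_upper (i j : 'I_N) : j = i.+1 :> nat -> h i j = -1.
Proof.
move=> ji; rewrite mxE ji eqxx (ltn_eqF (ltnSn i)).
by rewrite [i.+2 == i]gtn_eqF ?mulr0 ?oppr0 ?addr0.
Qed.

Lemma lind_stable (lam : C) (a : 'M[C]_N) :
  0 <= ail + aol -> 0 <= air + aor -> 0 <= beta ->
  0 < (ail + aol) + (air + aor) ->
  a != 0 -> l a = lam *: a -> complex.Re lam < 0.
Proof.
move=> zl0 zr0 b0 z0 an0 laE; rewrite ltNge; apply: contraNN an0 => lam0.
have supp := nondecaying_eigenvector_eq0 zl0 zr0 b0 laE lam0.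
(* The damping term vanishes on [a] entry by entry, leaving only the Hamiltonian part. *)
have commE : h *m a - a *m h = ('i * lam) *: a.
  apply/matrixP => i j; rewrite -/(ham_comm a) [RHS]mxE -mulrA.
  have := laE; move/matrixP => /(_ i j); rewrite lindE [RHS]mxE => <-.
  have -> : (damping i j)%:C * a i j = 0.
    by have [->|/supp->] := eqVneq (damping i j) 0; rewrite ?mul0r ?mulr0.
  by rewrite subr0 mulrA mulrN -expr2 sqr_i opprK mul1r.
(* A site coupled to a reservoir damps every entry of its row. *)
have rate_row (i : 'I_N) : 0 < site_rate i -> forall j, a i j = 0.
  move=> i0 j; apply: supp; rewrite gt_eqF//.
  rewrite /damping -addrA ltr_wpDr// addr_ge0 ?site_rate_ge0//.
  by rewrite mulr_ge0.
have [zl|zl] := ltP 0 (ail + aol).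
  apply/eqP; apply: hessenberg_intertwiner_eq0 commE _ => [i j|i j|i j i0].
  - exact: ham_upper_eq0.
  - by move=> /ham_upper ->; rewrite oppr_eq0 oner_eq0.
  - apply: rate_row; rewrite /site_rate i0 eqxx mulr1.
    by rewrite ltr_wpDr// mulr_ge0.
have zr : 0 < air + aor by rewrite (lt_le_trans z0)// gerDr.
(* Reversing the order of the rows reduces to a vanishing first row. *)
pose a' : 'M[C]_N := \matrix_(i, j) a (rev_ord i) j.
pose h' : 'M[C]_N := \matrix_(i, j) h (rev_ord i) (rev_ord j).
suff a'0 : a' = 0.
  apply/eqP/matrixP => i j; move/matrixP : a'0 => /(_ (rev_ord i) j).
  by rewrite !mxE rev_ordK.
apply: (@hessenberg_intertwiner_eq0 _ _ h' h a' ('i * lam)) => [i j ij|i j ij||i j i0].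
- rewrite mxE ham_sym ham_upper_eq0//=; have := ltn_ord i; have := ltn_ord j; lia.
- rewrite mxE ham_sym ham_upper ?oppr_eq0 ?oner_eq0//=.
  have := ltn_ord i; have := ltn_ord j; lia.
- apply/matrixP => i j; move/matrixP : commE => /(_ (rev_ord i) j).
  rewrite !mxE => <-; congr (_ - _).
    rewrite [RHS](reindex_inj rev_ord_inj); apply: eq_bigr => k _.
    by rewrite [h' i k]mxE [a' k j]mxE.
  by apply: eq_bigr => k _; rewrite [a' i k]mxE.
- rewrite mxE; apply: rate_row; rewrite /site_rate /= i0 subn1.
  rewrite (prednK (leq_ltn_trans (leq0n i) (ltn_ord i))) eqxx mulr1.
  by rewrite ltr_wpDl// mulr_ge0.
Qed.

Definition adjmx (a : 'M[C]_N) : 'M[C]_N := \matrix_(i, j) conjc (a j i).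

(** The adjoint changes the sign of the commutator and conjugates [- 'i], while [damping] is real
    and symmetric. This is what makes [R_infty] Hermitian. *)
Lemma lind_adjmx a : l (adjmx a) = adjmx (l a).
Proof.
apply/matrixP => i j; rewrite [RHS]mxE !lindE [X in _ - _ * X]mxE.
have -> : ham_comm (adjmx a) i j = - conjc (ham_comm a j i).
  rewrite !mxE rmorphB/= !rmorph_sum opprB; congr (_ - _).
    apply: eq_bigr => k _; rewrite rmorphM/= ham_real ham_sym mulrC.
    by rewrite [adjmx a k j]mxE.
  apply: eq_bigr => k _; rewrite rmorphM/= ham_real (ham_sym j k) mulrC.
  by rewrite [adjmx a i k]mxE.
rewrite rmorphB !rmorphM rmorphN/= oppr0.
have -> : damping j i = damping i j.
  by rewrite /damping eq_sym [site_rate j + _]addrC.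
congr (_ - _); rewrite mulrN -mulNr; congr (_ * _).
by apply/eqP; rewrite eq_complex /= ?oppr0 ?opprK !eqxx.
Qed.

(** The commutator and the dephasing vanish on the identity, so only the anticommutator
    contributes. *)
Lemma lind1 : l 1%:M =
  - ((2 * (ail + aol))%:C *: projp R N 1 + (2 * (air + aor))%:C *: projp R N N).
Proof.
apply/matrixP => i j; rewrite lindE.
have -> : ham_comm 1%:M i j = 0 by rewrite /ham_comm mulmx1 mul1mx subrr mxE.
rewrite !projpE !mxE eqSS /damping /site_rate.
have [<-|_] := eqVneq i j; last by rewrite !mulr0n; ring.
by rewrite !mulr1n !(rmorphD, rmorphM, rmorph_nat)/=; ring.
Qed.

End Lindbladian.

(** * Elimination at the first site and the current formula *)

Lemma adjmx_real_comb (R : realType) N (x y : R) (a b : 'M[R[i]]_N) :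
  adjmx (x%:C *: a + y%:C *: b) = x%:C *: adjmx a + y%:C *: adjmx b.
Proof. by apply/matrixP => i j; rewrite !mxE rmorphD !rmorphM/= !oppr0. Qed.

Lemma adjmx_projp (R : realType) N n : adjmx (projp R N n) = projp R N n.
Proof.
apply/matrixP => i j; rewrite projpE !mxE.
have [->|_] := eqVneq i j; first by rewrite !mulr1n conjc_nat.
by rewrite !mulr0n conjc0.
Qed.

(** The first site has a single neighbour, with hopping [-1]; the potential term cancels. This
    relates the commutator to the current through the first bond. *)
Lemma ham_comm00 (R : realType) n v (a : 'M[R[i]]_n.+2) :
  ham_comm v a ord0 ord0 = a ord0 (lift ord0 ord0) - a (lift ord0 ord0) ord0.
Proof.
transitivity (\sum_k ham n.+2 v ord0 k * (a k ord0 - a ord0 k)).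
  rewrite !mxE -sumrB; apply: eq_bigr => k _.
  by rewrite (ham_sym _ k) mulrBr [X in _ - X]mulrC.
rewrite !big_ord_recl big1 => [|k _]; last by rewrite ham_upper_eq0 ?mul0r.
by rewrite subrr mulr0 add0r addr0 ham_upper// mulN1r opprB.
Qed.

Lemma lind_lin_comb (R : realType) N v ail aol air aor beta (x y : R[i])
    (a b : 'M[R[i]]_N) :
  lind v ail aol air aor beta (x *: a + y *: b) =
    x *: lind v ail aol air aor beta a + y *: lind v ail aol air aor beta b.
Proof. by rewrite [LHS]linearD !linearZ. Qed.

Lemma lin_comb_mxE (F : fieldType) m n (x y : F) (a b : 'M[F]_(m, n)) i j :
  (x *: a + y *: b) i j = x * a i j + y * b i j.
Proof. by rewrite !mxE. Qed.

(* Here [Q = l^-1 X], that is, [- R_infty]. *)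
Lemma current_identity (R : realType) n v (ail aol air aor beta : R)
    (A P Q : 'M[R[i]]_n.+2) :
  injective (@lind R n.+2 v ail aol air aor beta) ->
  lind v ail aol air aor beta A = projp R n.+2 1 ->
  lind v ail aol air aor beta P = projp R n.+2 n.+2 ->
  lind v ail aol air aor beta Q =
    (2 * ail)%:C *: projp R n.+2 1 + (2 * air)%:C *: projp R n.+2 n.+2 ->
  (- (2 * complex.Im (Q (lift ord0 ord0) ord0)))%:C =
    - ((4 * (ail * aor - aol * air))%:C * P ord0 ord0).
Proof.
pose i1 : 'I_n.+2 := lift ord0 ord0; rewrite -/i1.
have d00 : damping ail aol air aor beta (ord0 : 'I_n.+2) ord0 = 2 * (ail + aol).
  by rewrite /damping /site_rate eqxx /= mulr0n mulr1n; ring.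
(* [lind] is generalized so that failed unifications do not unfold it. *)
have := fun a => @lindE R n.+2 v ail aol air aor beta a ord0 ord0.
rewrite d00 => {d00}; move: (@lind_lin_comb R n.+2 v ail aol air aor beta).
move: (@lind_adjmx R n.+2 v ail aol air aor beta).
move: (@lind1 R n.+2 v ail aol air aor beta).
move: (lind v ail aol air aor beta) => l l1 l_adj l_comb l00 l_inj lA lP lQ.
have one_AP :
    1%:M = (- (2 * (ail + aol))%:C) *: A + (- (2 * (air + aor))%:C) *: P.
  by apply: l_inj; rewrite l_comb l1 lA lP !scaleNr opprD.
have Q_AP : Q = (2 * ail)%:C *: A + (2 * air)%:C *: P.
  by apply: l_inj; rewrite l_comb lQ lA lP.
have Q_adj : adjmx Q = Q.
  by apply: l_inj; rewrite l_adj lQ adjmx_real_comb !adjmx_projp.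
have Q01 : Q ord0 i1 = conjc (Q i1 ord0) by rewrite -{1}Q_adj mxE.
(* [conjc z - z] is [- 2 i] times the imaginary part of [z]. *)
have current_im : (- (2 * complex.Im (Q i1 ord0)))%:C =
    - 'i * (Q ord0 i1 - Q i1 ord0).
  rewrite Q01; case: (Q i1 ord0) => x y.
  by apply/eqP; rewrite eq_complex /=; apply/andP; split; apply/eqP; ring.
have one00 : 1 = (- (2 * (ail + aol))%:C) * A ord0 ord0
    + (- (2 * (air + aor))%:C) * P ord0 ord0.
  by have /matrixP/(_ ord0 ord0) := one_AP; rewrite lin_comb_mxE mxE eqxx mulr1n.
(* At this entry [p_1] gives [1] and [p_N] gives [0], there being at least two sites. So the current
   is [2 * ail + 2 * (ail + aol) * Q_11]. *)
have /matrixP/(_ ord0 ord0) := lQ.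
rewrite l00 ham_comm00 -current_im {2}Q_AP !lin_comb_mxE.
rewrite !projpE !mxE /= !mulr1n mulr1 mulr0 addr0 => /eqP.
rewrite subr_eq => /eqP ->; move: (A _ _) (P _ _) one00 => x y one00.
(* Multiplying the source [2 * ail] by [1], written through [x = A_11] and [y = P_11], cancels the
   [x] terms and leaves [4 * (aol * air - ail * aor) * y]. *)
rewrite -[X in X + _]mulr1 {}one00.
rewrite !(rmorphB, rmorphD, rmorphM, rmorph_nat)/=; ring.
Qed.

Theorem theorem2p2 (R : realType) (N : nat) (v : nat -> R)
    (ail aol air aor beta : R) :
  (2 <= N)%N ->
  (exists K : R, forall n, `|v n| <= K) ->
  0 <= ail -> 0 <= aol -> 0 <= air -> 0 <= aor -> 0 <= beta ->
  0 < (ail + aol) + (air + aor) ->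
  let l := @lind R N v ail aol air aor beta in
  let X := (2 * ail)%:C *: projp R N 1 + (2 * air)%:C *: projp R N N in
  let c := 4 * (ail * aor - aol * air) in
  let I := cimproper (fun t => cinner (basis_vec R N 1) (semigroup l t (projp R N N) *m basis_vec R N 1)) in
  [/\ lin_mx l \in unitmx,
      (forall i j : 'I_N, cimproper_cvg (fun s => semigroup l s X i j)),
      cimproper_cvg (fun t => cinner (basis_vec R N 1) (semigroup l t (projp R N N) *m basis_vec R N 1)),
      (current N v ail aol air aor beta)%:C = c%:C * I
    & c%:C * I = - (c%:C * cinner (basis_vec R N 1) (linv l (projp R N N) *m basis_vec R N 1))].
Proof.
(* With [N = n.+2], sites 1 and 2 become the indices [ord0] and [lift ord0 ord0]. *)
case: N => [//|[//|n]] _ _ ail0 aol0 air0 aor0 beta0 z0 l X c I.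
have zl0 : 0 <= ail + aol by rewrite addr_ge0.
have zr0 : 0 <= air + aor by rewrite addr_ge0.
have l_stable lam a : a != 0 -> l a = lam *: a -> complex.Re lam < 0.
  exact: lind_stable.
have lK b : l (linv l b) = b by exact: (linvK l_stable).
have l_inj : injective l.
  by move=> a b /(linv_unique l_stable) ->; exact/esym/(linv_unique l_stable).
have IE : I = - linv l (projp R n.+2 n.+2) ord0 ord0.
  rewrite -(cimproper_semigroup l_stable); congr cimproper; apply/funext => t.
  exact: (cinner_basis_mulmx _ ord0 ord0).
split.
- exact: (stable_unitmx l_stable).
- by move=> i j; exact: (cimproper_cvg_semigroup l_stable).
- rewrite (_ : (fun t => _) =
      fun t => semigroup l t (projp R n.+2 n.+2) ord0 ord0).
    exact: (cimproper_cvg_semigroup l_stable).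
  by apply/funext => t; exact: (cinner_basis_mulmx _ ord0 ord0).
- have RinfE : Rinf n.+2 v ail aol air aor beta = - linv l X.
    apply/matrixP => i j; rewrite [LHS]mxE [RHS]mxE.
    exact: (cimproper_semigroup l_stable).
  rewrite /current (cinner_basis_mulmx _ (lift ord0 ord0) ord0) RinfE IE mulrN.
  rewrite -(current_identity l_inj (lK _) (lK _) (lK _)).
  rewrite -mulrN; congr (_ * _)%:C.
  by rewrite [X in complex.Im X]mxE raddfN.
- rewrite IE mulrN; congr (- (_ * _)); apply/esym.
  exact: (cinner_basis_mulmx _ ord0 ord0).
Qed.
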